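(* Let $R$ be a power-serieswise Armendariz ring. Then the following are equivalent: (1) $R$ is nil-reversible. (2) $R[x]$ is nil-reversible. (3) $R[[x]]$ is nil-reversible.
   Context: All rings are associative with identity. For a ring $R$, $N(R)$ denotes the set of all nilpotent elements of $R$. For $a\in R$, $l(a)=\{x\in R: xa=0\}$ and $r(a)=\{x\in R: ax=0\}$. A ring $R$ is nil-reversible if $l(a)=r(a)$ for every $a\in N(R)$. A ring $R$ is power-serieswise Armendariz if whenever $f(x)=\sum_{i=0}^{\infty}w_ix^i$ and $g(x)=\sum_{j=0}^{\infty}h_jx^j$ in $R[[x]]$ satisfy $f(x)g(x)=0$, then $w_ih_j=0$ for all $i,j$. *)

(* Defs.v *)
From HB Require Import structures.
From mathcomp Require Import all_boot all_algebra.
From mathcomp Require Import boolp classical_sets.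

Set Implicit Arguments.
Unset Strict Implicit.
Unset Printing Implicit Defensive.

Import GRing.Theory.

Local Open Scope ring_scope.

(* The power series \sum_i (s i) x^i is the sequence of its coefficients,     *)
(* wrapped in a record because nat -> R already carries the pointwise ring    *)
(* structure.  As for polynomials, x commutes with the coefficients.          *)
Record powerseries (R : Type) := PowerSeries { coefps :> nat -> R }.

Notation "{ 'powerseries' R }" := (powerseries R)
  (at level 0, R at level 2, format "{ 'powerseries'  R }") : type_scope.

HB.instance Definition _ (R : Type) := gen_eqMixin {powerseries R}.
HB.instance Definition _ (R : Type) := gen_choiceMixin {powerseries R}.

Lemma powerseriesP (R : Type) (s t : {powerseries R}) : s =1 t <-> s = t.
Proof.
split=> [|-> //]; case: s t => [s] [t] /= eq_st.
by congr PowerSeries; apply/funext.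
Qed.

Section PowerSeriesRing.

Variable R : pzRingType.
Implicit Types s t u : {powerseries R}.

Definition zero_ps : {powerseries R} := PowerSeries (fun=> 0).
Definition one_ps : {powerseries R} := PowerSeries (fun n => (n == 0)%:R).
Definition opp_ps s := PowerSeries (fun n => - s n).
Definition add_ps s t := PowerSeries (fun n => s n + t n).
Definition mul_ps s t :=
  PowerSeries (fun n => \sum_(i < n.+1) s i * t (n - i)%N).

Fact add_psA : associative add_ps.
Proof. by move=> s t u; apply/powerseriesP => n /=; rewrite addrA. Qed.

Fact add_psC : commutative add_ps.
Proof. by move=> s t; apply/powerseriesP => n /=; rewrite addrC. Qed.

Fact add_0ps : left_id zero_ps add_ps.
Proof. by move=> s; apply/powerseriesP => n /=; rewrite add0r. Qed.

Fact add_Nps : left_inverse zero_ps opp_ps add_ps.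
Proof. by move=> s; apply/powerseriesP => n /=; rewrite addNr. Qed.

HB.instance Definition _ :=
  GRing.isZmodule.Build {powerseries R} add_psA add_psC add_0ps add_Nps.

Fact coef_mul_ps s t n : mul_ps s t n = \sum_(i < n.+1) s i * t (n - i)%N.
Proof. by []. Qed.

Fact coef_mul_ps_rev s t n :
  mul_ps s t n = \sum_(i < n.+1) s (n - i)%N * t i.
Proof.
rewrite /= (reindex_inj rev_ord_inj) /=.
by apply: eq_bigr => i _; rewrite subSS subKn // -ltnS.
Qed.

Fact mul_psA : associative mul_ps.
Proof.
move=> s t u; apply/powerseriesP => i.
rewrite coef_mul_ps [RHS]coef_mul_ps_rev.
pose coef3 j k := s j * (t (i - j - k)%N * u k).
transitivity (\sum_(j < i.+1) \sum_(k < i.+1 | (k <= i - j)%N) coef3 j k).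
  apply: eq_bigr => j _; rewrite coef_mul_ps_rev big_distrr /=.
  by rewrite (big_ord_narrow_leq (leq_subr _ _)).
rewrite (exchange_big_dep predT) //=; apply: eq_bigr => k _.
transitivity (\sum_(j < i.+1 | (j <= i - k)%N) coef3 j k).
  apply: eq_bigl => j; rewrite -ltnS -(ltnS j) -!subSn ?leq_ord //.
  by rewrite -subn_gt0 -(subn_gt0 j) -!subnDA addnC.
rewrite (big_ord_narrow_leq (leq_subr _ _)) big_distrl /=.
by apply: eq_bigr => j _; rewrite /coef3 -!subnDA addnC mulrA.
Qed.

Fact mul_1ps : left_id one_ps mul_ps.
Proof.
move=> s; apply/powerseriesP => n /=; rewrite big_ord_recl subn0 mul1r.
by rewrite big1 ?addr0 // => i _; rewrite mul0r.
Qed.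

Fact mul_ps1 : right_id one_ps mul_ps.
Proof.
move=> s; apply/powerseriesP => n; rewrite coef_mul_ps_rev /=.
rewrite big_ord_recl subn0 mulr1.
by rewrite big1 ?addr0 // => i _; rewrite mulr0.
Qed.

Fact mul_psDl : left_distributive mul_ps add_ps.
Proof.
move=> s t u; apply/powerseriesP => n /=; rewrite -big_split /=.
by apply: eq_bigr => i _; rewrite mulrDl.
Qed.

Fact mul_psDr : right_distributive mul_ps add_ps.
Proof.
move=> s t u; apply/powerseriesP => n /=; rewrite -big_split /=.
by apply: eq_bigr => i _; rewrite mulrDr.
Qed.

HB.instance Definition _ := GRing.Zmodule_isPzRing.Build {powerseries R}
  mul_psA mul_1ps mul_ps1 mul_psDl mul_psDr.

Lemma coefps0 n : (0 : {powerseries R}) n = 0. Proof. by []. Qed.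

Lemma coefps1 n : (1 : {powerseries R}) n = (n == 0)%:R. Proof. by []. Qed.

Lemma coefpsN s n : (- s) n = - s n. Proof. by []. Qed.

Lemma coefpsD s t n : (s + t) n = s n + t n. Proof. by []. Qed.

Lemma coefpsM s t n : (s * t) n = \sum_(i < n.+1) s i * t (n - i)%N.
Proof. by []. Qed.

End PowerSeriesRing.

Section NilReversible.

Local Open Scope classical_set_scope.

Variable R : pzRingType.

Definition nilpotents : set R := [set a | exists n : nat, a ^+ n = 0].

Definition left_annihilator (a : R) : set R := [set x | x * a = 0].

Definition right_annihilator (a : R) : set R := [set x | a * x = 0].

Definition nil_reversible :=
  forall a : R, nilpotents a -> left_annihilator a = right_annihilator a.

Definition powerserieswise_Armendariz :=
  forall f g : {powerseries R},
    f * g = 0 -> forall i j : nat, f i * g j = 0.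

End NilReversible.

Arguments nil_reversible R : clear implicits.
Arguments powerserieswise_Armendariz R : clear implicits.

(* Main.v *)
From HB Require Import structures.
Require Import Defs.
From mathcomp Require Import all_boot all_algebra.
From mathcomp Require Import classical_sets.

(** The inclusions of [R] into [{poly R}] and of [{poly R}] into
    [{powerseries R}] are injective ring morphisms, and nil-reversibility
    descends along injective morphisms ([nil_reversible_inj]).
    The Armendariz condition is what allows the return from [R] to
    [{powerseries R}], which closes a cycle of implications.

    For that return, the condition makes [f * g = 0] equivalent to the vanishing
    of all the products [f i * g j], so that reversing [f * g = 0] amounts to
    reversing products in [R].  These can be reversed because the coefficients
    of a nilpotent power series are themselves nilpotent
    ([nilpotent_coefps]). *)

Set Implicit Arguments.
Unset Strict Implicit.
Unset Printing Implicit Defensive.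

Import GRing.Theory.

Local Open Scope ring_scope.

Lemma nil_reversibleP (R : pzRingType) :
  nil_reversible R <->
  (forall a b : R, nilpotents a -> (b * a = 0 <-> a * b = 0)).
Proof.
split=> [revR a b nila | revR a nila].
  by have /seteqP[lr rl] := revR a nila; split; [apply: lr | apply: rl].
by apply/seteqP; split=> b /(revR a b nila).
Qed.

Lemma nil_reversible_inj (A B : pzRingType) (phi : {rmorphism A -> B}) :
  injective phi -> nil_reversible B -> nil_reversible A.
Proof.
move=> phi_inj /nil_reversibleP revB; apply/nil_reversibleP => a b [n an0].
have phi_eq0 x : x = 0 <-> phi x = 0.
  by split=> [->|phix0]; [rewrite rmorph0 | apply: phi_inj; rewrite rmorph0].
rewrite !phi_eq0 !rmorphM; apply: revB.
by exists n; rewrite -rmorphXn an0 rmorph0.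
Qed.

Definition ps_of_poly (R : nzRingType) (p : {poly R}) : {powerseries R} :=
  PowerSeries (fun n => p`_n).

Section PsOfPoly.

Variable R : nzRingType.

Fact ps_of_poly_is_zmod_morphism : zmod_morphism (@ps_of_poly R).
Proof. by move=> p q; apply/powerseriesP => n; rewrite /= coefB. Qed.

Fact ps_of_poly_is_monoid_morphism : monoid_morphism (@ps_of_poly R).
Proof.
split=> [|p q]; apply/powerseriesP => n; first by rewrite /= coef1.
by rewrite /= coefM.
Qed.

HB.instance Definition _ :=
  GRing.isZmodMorphism.Build {poly R} {powerseries R} (@ps_of_poly R)
    ps_of_poly_is_zmod_morphism.
HB.instance Definition _ :=
  GRing.isMonoidMorphism.Build {poly R} {powerseries R} (@ps_of_poly R)
    ps_of_poly_is_monoid_morphism.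

Lemma ps_of_poly_inj : injective (@ps_of_poly R).
Proof. by move=> p q /powerseriesP eq_pq; apply/polyP. Qed.

Lemma coefps_mulC (c : R) (f : {powerseries R}) n :
  (ps_of_poly c%:P * f) n = c * f n.
Proof.
rewrite coefpsM big_ord_recl /= coefC subn0 big1 ?addr0 // => i _.
by rewrite coefC mul0r.
Qed.

End PsOfPoly.

Section Armendariz.

Variable R : nzRingType.
Hypothesis armR : powerserieswise_Armendariz R.

Lemma Armendariz_mul_eq0 (f g : {powerseries R}) :
  f * g = 0 <-> (forall i j, f i * g j = 0).
Proof.
split=> [|fg0]; first exact: armR.
by apply/powerseriesP => n; rewrite coefpsM big1.
Qed.

(** The constant [c] on the left accumulates the coefficients already extracted:
    applied to [(c * f) * f ^+ n], the Armendariz condition trades one factor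
    [f] for the factor [f i] of the new constant [c * f i]. *)
Lemma Armendariz_mulC_exp (f : {powerseries R}) i n (c : R) :
  ps_of_poly c%:P * f ^+ n = 0 -> c * f i ^+ n = 0.
Proof.
elim: n c => [|n IHn] c.
  by move=> /(congr1 (fun s : {powerseries R} => s 0)); rewrite coefps_mulC.
rewrite !exprS !mulrA => /Armendariz_mul_eq0 cff0; apply: IHn.
by apply/powerseriesP => j; rewrite coefps_mulC -(coefps_mulC c f) cff0.
Qed.

Lemma nilpotent_coefps (f : {powerseries R}) i :
  nilpotents f -> nilpotents (f i).
Proof.
move=> [n fn0]; exists n; rewrite -[LHS]mul1r.
by apply: Armendariz_mulC_exp; rewrite fn0 mulr0.
Qed.

Lemma nil_reversible_powerseries :
  nil_reversible R -> nil_reversible {powerseries R}.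
Proof.
move=> /nil_reversibleP revR; apply/nil_reversibleP => f g nilf.
rewrite !Armendariz_mul_eq0.
by split=> fg0 i j; apply/(revR (f _)); rewrite ?fg0 //;
  apply: nilpotent_coefps.
Qed.

End Armendariz.

Theorem proposition3p14 (R : nzRingType)
    (armR : powerserieswise_Armendariz R) :
  (nil_reversible R <-> nil_reversible {poly R}) /\
  (nil_reversible {poly R} <-> nil_reversible {powerseries R}).
Proof.
have ps_poly := nil_reversible_inj (@ps_of_poly_inj R).
have poly_R := nil_reversible_inj (@polyC_inj R).
have R_ps := nil_reversible_powerseries armR.
by split; split=> ?; auto.
Qed.
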